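(* Let $G$ be a group of rank $k$ and let $S$ be a generating set of $G$ of size $k$. Then there exists an explicit set $A\subseteq G$ such that $|A|=2^k$, $L_{G,S}(A)=k$ and $\delta(A;G)\ge \frac12$.
   Context: The rank of a finitely generated group $G$ is the minimal size of a generating set of $G$. Finite subsets may be treated as multi-sets (finite unordered collections of elements of $G$, possibly with repetitions), with sizes counted with multiplicity. The detection probability of a finite (multi-)subset $A$ of $G$ is $\delta(A;G)=\inf\{1-\frac{|A\cap H|}{|A|} : H\lneq G\}$, over all proper subgroups $H$ of $G$; thus $\delta(A;G)\ge\delta$ means $|A\cap H|\le(1-\delta)|A|$ for every proper subgroup $H$. For a generating set $S$ of $G$, the length $L_{G,S}(A)$ of a finite subset $A\subseteq G$ is the smallest $\ell$ such that every element of $A$ can be written as a word of length at most $\ell$ in $S\cup S^{-1}$. ''Explicit'' is used informally: $A$ is given by a deterministic construction from $S$ rather than by a probabilistic existence argument. *)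

(* Defs.v *)
From HB Require Import structures.
From mathcomp Require Import all_boot all_order all_algebra finmap.
From mathcomp Require Import all_classical all_reals ereal.

Set Implicit Arguments.
Unset Strict Implicit.
Unset Printing Implicit Defensive.

Import Order.TTheory GRing.Theory Num.Theory.

Local Open Scope classical_set_scope.
Local Open Scope group_scope.

Definition is_least (P : set nat) (n : nat) : Prop :=
  P n /\ forall m, P m -> (n <= m)%N.

Definition is_subgroup (G : groupType) (H : set G) : Prop :=
  group_closed (mem H).

Definition proper_subgroup (G : groupType) (H : set G) : Prop :=
  is_subgroup H /\ H <> setT.

Definition generates (G : groupType) (S : {fset G}) : Prop :=
  smallest (@is_subgroup G) [set` S] = setT.

(* In particular this entails that G is finitely generated. *)
Definition has_rank (G : groupType) (k : nat) : Prop :=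
  is_least [set n | exists2 S : {fset G}, generates S & #|` S| = n] k.

(* Finite multisets of elements of G are represented by sequences, the order
   of which is irrelevant below; a finite set {fset G} coerces to one without
   repetitions. *)

Definition word_over (G : groupType) (S : {fset G}) (w : seq G) : bool :=
  all (fun y => (y \in S) || (y^-1 \in S)) w.

Definition has_length (G : groupType) (S : {fset G}) (A : seq G) (l : nat)
  : Prop :=
  is_least [set n | forall x, x \in A ->
              exists2 w : seq G, word_over S w &
                (size w <= n)%N /\ x = \prod_(y <- w) y] l.

(* The infimum is taken in the extended reals, where it is +oo for the trivial
   group, which has no proper subgroup. *)
Definition detection_prob (R : realType) (G : groupType) (A : seq G)
  : \bar R :=
  ereal_inf [set (1 - (count (mem H) A)%:R / (size A)%:R)%R%:E
            | H in [set H : set G | proper_subgroup H]].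

(* Formal words in k letters and their inverses; (i, true) is the inverse of
   the letter i. *)
Definition word (k : nat) := seq ('I_k * bool).

Definition word_eval (k : nat) (G : groupType) (s : k.-tuple G) (w : word k)
  : G :=
  \prod_(l <- w) (if l.2 then (tnth s l.1)^-1 else tnth s l.1).

(* Main.v *)
(* Let A consist of the products s_1^e_1 ... s_k^e_k with e_i in {0,1}. Since S
   has minimal size, every x in S lies outside some subgroup containing the rest
   of S. If two of the products coincide, cancelling up to the first index i
   where they differ puts s_i in the subgroup generated by the s_j with j > i.
   A word of length less than k misses some s_i, so it cannot equal
   s_1 ... s_k. Finally, if H is a proper subgroup and i is the last index with
   s_i not in H, then flipping e_i changes the left coset of H in which the
   product lies, so at least half of the products are outside H. *)

Require Import Defs.
From HB Require Import structures.
From mathcomp Require Import all_boot all_order all_algebra finmap.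
From mathcomp Require Import all_classical all_reals ereal.

Set Implicit Arguments.
Unset Strict Implicit.
Unset Printing Implicit Defensive.

Import Order.TTheory GRing.Theory Num.Theory.

(** A sublist encodes an exponent vector with entries in {0,1}: the kept positions are those with
    exponent 1. *)
Fixpoint sublists (T : Type) (s : seq T) : seq (seq T) :=
  if s is x :: s' then sublists s' ++ map (cons x) (sublists s') else [:: [::]].

Lemma size_sublists (T : Type) (s : seq T) : size (sublists s) = 2 ^ size s.
Proof.
by elim: s => //= x s IHs; rewrite size_cat size_map IHs expnS mul2n addnn.
Qed.

Lemma map_sublists (T U : Type) (f : T -> U) (s : seq T) :
  map (map f) (sublists s) = sublists (map f s).
Proof.
elim: s => //= x s IHs; rewrite map_cat -IHs -!map_comp.
by congr (_ ++ _); apply: eq_map.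
Qed.

Lemma sublists_self (T : eqType) (s : seq T) : s \in sublists s.
Proof. by elim: s => //= x s IHs; rewrite mem_cat map_f ?orbT. Qed.

Lemma sublistsP (T : eqType) (s t : seq T) :
  t \in sublists s -> {subset t <= s} /\ size t <= size s.
Proof.
elim: s t => [|x s IHs] t /=; first by rewrite inE => /eqP ->.
rewrite mem_cat => /orP[/IHs[ts tk]|/mapP[u /IHs[us uk] ->]].
  by split=> [y /ts ys|]; [rewrite inE ys orbT | apply: leqW].
by split=> // y; rewrite !inE => /orP[->//|/us ->]; rewrite orbT.
Qed.

Local Open Scope classical_set_scope.
Local Open Scope group_scope.

Section Subgroups.
Variables (G : groupType) (H : set G).
Hypothesis sgH : is_subgroup H.

Lemma subgroup1 : 1 \in H.
Proof. exact: sgH.1. Qed.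

Lemma subgroupM x y : x \in H -> y \in H -> x * y \in H.
Proof. exact: group_closedM sgH x y. Qed.

Lemma subgroupV x : (x^-1 \in H) = (x \in H).
Proof.
apply/idP/idP => Hx; last exact: (group_closedV sgH Hx).
by rewrite -[x]invgK; apply: (group_closedV sgH Hx).
Qed.

Lemma subgroupMr x y : x \in H -> (y * x \in H) = (y \in H).
Proof.
move=> Hx; apply/idP/idP => Hy; last exact: subgroupM.
by rewrite -[y](mulgK x) subgroupM ?subgroupV.
Qed.

Lemma subgroupMl x y : x \in H -> (x * y \in H) = (y \in H).
Proof.
move=> Hx; apply/idP/idP => Hy; last exact: subgroupM.
by rewrite -[y](mulKg x) subgroupM ?subgroupV.
Qed.

Lemma subgroup_prod (w : seq G) : {subset w <= H} -> \prod_(y <- w) y \in H.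
Proof.
move=> wH; rewrite big_seq; elim/big_ind: _ => //; first exact: subgroup1.
exact: subgroupM.
Qed.

End Subgroups.

Definition subproducts (G : groupType) (s : seq G) : seq G :=
  [seq \prod_(y <- t) y | t <- sublists s].

Lemma subproducts_cons (G : groupType) (x : G) (s : seq G) :
  subproducts (x :: s) = subproducts s ++ [seq x * p | p <- subproducts s].
Proof.
rewrite /subproducts /= map_cat -!map_comp; congr (_ ++ _).
by apply: eq_map => t /=; rewrite big_cons.
Qed.

Lemma subproducts_subgroup (G : groupType) (H : set G) (s : seq G) :
  is_subgroup H -> {subset s <= H} -> {subset subproducts s <= H}.
Proof.
move=> sgH sH _ /mapP[t /sublistsP[ts _] ->].
by apply: subgroup_prod => // y /ts /sH.
Qed.

(** Any subgroup separating [x] from the other entries serves as witness, so the subgroup they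
    generate is never constructed. *)
Definition irredundant (G : groupType) (s : seq G) : Prop :=
  forall x, x \in s ->
    exists2 H : set G, is_subgroup H & {in s, forall y, (y \in H) = (y != x)}.

Lemma subproducts_uniq (G : groupType) (s : seq G) :
  uniq s -> irredundant s -> uniq (subproducts s).
Proof.
elim: s => [|x s IHs] //= /andP[xs us] irr; rewrite subproducts_cons cat_uniq.
have irr_s : irredundant s.
  move=> y ys; have [|H sgH HE] := irr y; first by rewrite inE ys orbT.
  by exists H => // z zs; rewrite HE // inE zs orbT.
rewrite (map_inj_uniq (mulgI x)) IHs //=.
(* If [x * q] were a subproduct of [s], it would lie with [q] in the subgroup separating [x] from
   [s], forcing [x] into it. *)
rewrite andbT; apply/hasPn => _ /mapP[q qs ->] /=; apply/negP => xqs.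
have [|H sgH HE] := irr x; first exact: mem_head.
have /(subproducts_subgroup sgH) sH : {subset s <= H}.
  by move=> z zs; rewrite HE ?inE ?zs ?orbT//; apply: contraNneq xs => <-.
have := sH _ xqs; rewrite (subgroupMr sgH _ (sH _ qs)).
by rewrite HE ?mem_head ?eqxx.
Qed.

(* Counting over the coset [g^-1 H] instead of [H] makes the induction pass. *)
Lemma subproducts_count (G : groupType) (H : set G) (s : seq G) (g : G) :
  is_subgroup H -> has [predC H] s ->
  (count [pred p | g * p \in H] (subproducts s)).*2 <= size (subproducts s).
Proof.
move=> sgH; elim: s g => // x s IHs g /=.
rewrite subproducts_cons count_cat size_cat doubleD (size_map (fun p => x * p)).
have -> : count [pred p | g * p \in H] [seq x * p | p <- subproducts s]
    = count [pred p | g * x * p \in H] (subproducts s).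
  rewrite (count_map (fun p => x * p)); apply: eq_count => p /=.
  by rewrite mulgA.
case: (boolP (has [predC H] s)) => [sH _|]; first by rewrite leq_add ?IHs.
(* Here [x] is the last entry outside [H], so membership of [h * p] depends on [h] alone. As [g] and
   [g * x] are not both in [H], at most one half counts. *)
move=> /hasPn sH; rewrite orbF => xH.
have /(subproducts_subgroup sgH) pH : {subset s <= H}.
  by move=> y /sH /negPn.
have count_coset h :
    count [pred p | h * p \in H] (subproducts s)
    = ((h \in H) * size (subproducts s))%N.
  rewrite (eq_in_count (a2 := fun=> h \in H)); last first.
    by move=> p /pH Hp /=; rewrite (subgroupMr sgH).
  by case: (h \in H); rewrite ?count_predT ?count_pred0 ?mul1n.
rewrite !count_coset; case: (boolP (g \in H)) => gH.
  by rewrite (subgroupMl sgH) // (negPf xH) addn0 mul1n addnn.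
by rewrite add0n addnn leq_double; case: (_ \in H); rewrite ?mul1n.
Qed.

(* A word shorter than [S] avoids some letter of [S], hence lies in a subgroup
   that contains all the other letters. *)
Lemma irredundant_word_size (G : groupType) (S : {fset G}) (s w : seq G) :
  irredundant s -> uniq s -> s =i S -> word_over S w ->
  \prod_(y <- s) y = \prod_(y <- w) y -> size s <= size w.
Proof.
move=> irr us sS /allP wS sw; rewrite leqNgt; apply/negP => ltws.
(* [f] strips inverses, turning the letters of [w] into elements of [S]; by pigeonhole they miss
   some [x] in [s]. *)
pose f y := if y \in S then y else y^-1.
have /allPn[x xs xw] : ~~ all (mem (map f w)) s.
  apply/negP => /allP /(uniq_leq_size us).
  by rewrite size_map leqNgt ltws.
have [H sgH HE] := irr x xs.
have wH : \prod_(y <- w) y \in H.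
  apply: subgroup_prod => // y yw.
  have fyx : f y != x by apply: contraNneq xw => <-; apply: map_f.
  have := wS y yw; move: fyx; rewrite /f -!sS.
  case: ifP => [ys yx _|_ yx /= ys]; first by rewrite HE.
  by rewrite -(subgroupV sgH) HE.
suff : x \in H by rewrite HE ?eqxx.
(* As [x] occurs once in [s], the factors on both sides of it lie in [H] and can be cancelled from
   the product. *)
move: wH; rewrite -sw; case/splitPr: xs us HE {irr sS ltws xw sw} => s1 s2.
rewrite -cat1s uniq_catCA /= mem_cat negb_or => /andP[/andP[x1 x2] _] HE.
have pH t : {subset t <= s1 ++ x :: s2} -> x \notin t ->
    \prod_(y <- t) y \in H.
  move=> st xt; apply: subgroup_prod => // y yt.
  by rewrite HE ?st//; apply: contraNneq xt => <-.
rewrite big_cat /= big_cons (subgroupMl sgH) ?(subgroupMr sgH) //; apply: pH => //.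
  by move=> y y2; rewrite mem_cat inE y2 !orbT.
by move=> y y1; rewrite mem_cat y1.
Qed.

Lemma generates_notin_proper (G : groupType) (S : {fset G}) (H : set G) :
  generates S -> proper_subgroup H -> exists2 x, x \in S & x \notin H.
Proof.
move=> genS [sgH properH]; apply: contrapT => noX; apply: properH.
apply/seteqP; split=> // x _.
suff : smallest (@is_subgroup G) [set` S] `<=` H by apply; rewrite genS.
apply: smallest_sub => // y /= yS; apply/set_mem/negPn/negP => yH.
by apply: noX; exists y.
Qed.

(** By minimality [S] without [x] does not generate. Were there no separating subgroup, every
    subgroup containing the rest of [S] would contain [x], hence all of [G]. *)
Lemma rank_irredundant (G : groupType) (S : {fset G}) (s : seq G) :
  has_rank G #|` S| -> generates S -> s =i S -> irredundant s.
Proof.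
move=> [_ minS] genS sS x xs.
have : ~ generates (S `\ x)%fset.
  move=> genSx; have /minS : exists2 T : {fset G}, generates T &
    #|` T| = #|` S `\ x|%fset by exists (S `\ x)%fset.
  by rewrite [in X in (X <= _)](cardfsD1 x) -sS xs add1n ltnn.
move=> ngen; apply: contrapT => noH; apply: ngen.
apply/seteqP; split=> // g _ H [sgH SxH].
have xH : x \in H.
  apply: contrapT => xH; apply: noH; exists H => // y; rewrite sS => yS.
  have [->|yx] := eqVneq y x; first exact/negP.
  by apply/mem_set/SxH => /=; rewrite !inE yx.
suff : smallest (@is_subgroup G) [set` S] g by apply; split=> // y /= yS;
  have [->|yx] := eqVneq y x; [exact: set_mem | apply: SxH; rewrite /= !inE yx].
by rewrite genS.
Qed.

Lemma word_eval_positive (k : nat) (G : groupType) (s : k.-tuple G) :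
  [seq word_eval s w | w <- sublists [seq (i, false) | i <- enum 'I_k]]
  = subproducts s.
Proof.
rewrite -map_sublists -map_comp -[in RHS](map_tnth_enum s) /subproducts.
rewrite -map_sublists -map_comp; apply: eq_map => t /=.
by rewrite /word_eval !big_map.
Qed.

Local Close Scope group_scope.
Local Close Scope classical_set_scope.

(* "Explicit": A is read off from any listing s of S by a fixed list W of
   formal words that depends on k only, neither on G nor on S. *)
Theorem theorem1p6 (k : nat) :
  exists W : seq (word k),
  forall (R : realType) (G : groupType) (S : {fset G}),
  has_rank G k -> generates S -> #|` S| = k ->
  forall s : k.-tuple G, s =i S ->
  exists A : {fset G},
    [/\ A = [fset word_eval s w | w in W]%fset,
        #|` A| = (2 ^ k)%N,
        has_length S A k &
        ((2%:R^-1)%:E <= detection_prob R A)%E].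
Proof.
exists (sublists [seq (i, false) | i <- enum 'I_k]) => R G S rkG genS cardS s sS.
have irr : irredundant s by apply: rank_irredundant sS; rewrite ?cardS.
have us : uniq s.
  by rewrite (@eq_uniq _ _ S) ?fset_uniq ?size_tuple ?cardS.
have up := subproducts_uniq us irr.
pose W := sublists [seq (i, false) | i <- enum 'I_k].
pose A := [fset word_eval s w | w in W]%fset; exists A.
have AE : A =i subproducts s.
  move=> x; rewrite -word_eval_positive.
  by apply/imfsetP/mapP => -[w wW ->]; exists w.
(* Both sides are duplicate-free, so sizes and counts transfer from the list of products to the
   set. *)
have pA : perm_eq A (subproducts s) by apply: uniq_perm.
have sizeA : size A = 2 ^ k.
  by rewrite (perm_size pA) size_map size_sublists size_tuple.
split=> //.
- split=> [x|n lenA].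
    rewrite AE => /mapP[t /sublistsP[ts tk] ->].
    exists t; last by rewrite size_tuple in tk.
    by apply/allP => y /ts; rewrite sS => ->.
  have [|w wS [wn sw]] := lenA (\prod_(y <- s) y)%g.
    by rewrite AE map_f // sublists_self.
  rewrite -(size_tuple s); apply: leq_trans wn.
  exact: irredundant_word_size wS sw.
(* The bound is checked at each proper subgroup, so the trivial group, having none, needs no
   separate case. *)
- apply: le_ereal_inf_tmp => _ [H properH <-].
  have [x xS xH] := generates_notin_proper genS properH.
  have sH : has [predC H] s by apply/hasP; exists x; rewrite ?sS.
  have := subproducts_count 1%g properH.1 sH.
  rewrite (eq_count (a2 := mem H)); last by move=> p /=; rewrite mul1g.
  rewrite -(permP pA) -(perm_size pA) lee_fin sizeA.
  rewrite -(ler_nat R) -muln2 natrM => cnt.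
  rewrite lerBrDr [leRHS]splitr mul1r lerD2l.
  by rewrite ler_pdivrMr ?ltr0n ?expn_gt0// mulrC ler_pdivlMr ?ltr0n.
Qed.
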